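(* Assume that for every $\rho\in(0,\infty)^K$ with $\nabla\phi(\rho)=0$ the Hessian matrix $\left(\frac{\partial^2g}{\partial y_m\partial y_n}(\nu_\rho)\right)_{m,n\in\mathcal{X}}$ has only nonzero eigenvalues. Then: 1. A vector $\rho\in(0,\infty)^K$ is a local minimum of the function $\phi$ if and only if $\nu_\rho$ is a local minimum of the function $g$ on $\mathcal{P}(\mathcal{X})$. 2. If $\rho\in(0,\infty)^K$ is a saddle point for $\phi$, then $\nu_\rho$ is a saddle point for $g$ on $\mathcal{P}(\mathcal{X})$.
   Context: Fix integers $K\ge1$, $C\ge1$, integers $A_1,\dots,A_K$ with $1\le A_k\le C$ and rates $\lambda_k>0$, $\gamma_k>0$, $\mu_k\ge0$ for $1\le k\le K$. Let $$\mathcal{X}=\{n=(n_k)\in\mathbb{N}^K: A_1n_1+\cdots+A_Kn_K\le C\}\quad(\mathbb{N}=\{0,1,2,\dots\}),$$ and let $\mathcal{P}(\mathcal{X})$ be the set of probability distributions $y=(y_n)_{n\in\mathcal{X}}$ on $\mathcal{X}$. Write $\langle\mathbb{I}_k,y\rangle=\sum_{m\in\mathcal{X}}m_ky_m$, $n!=\prod_kn_k!$, $\rho^n=\prod_k\rho_k^{n_k}$. For $\rho\in(0,\infty)^K$, $$Z(\rho)=\sum_{n\in\mathcal{X}}\frac{\rho^n}{n!},\qquad \nu_\rho(n)=\frac1{Z(\rho)}\frac{\rho^n}{n!}\quad(n\in\mathcal{X}),$$ $$\phi(\rho)=-\log Z(\rho)+\sum_{k=1}^K(\beta_k\rho_k-\alpha_k\log\rho_k),\qquad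 \alpha_k=\frac{\lambda_k}{\gamma_k},\quad \beta_k=\frac{\gamma_k+\mu_k}{\gamma_k}.$$ The function $g$ on $\mathcal{P}(\mathcal{X})$ is $$g(y)=\sum_{n\in\mathcal{X}}y_n\log(n!\,y_n)-\sum_{k=1}^{K}\int_0^{\langle\mathbb{I}_k,y\rangle}\log\frac{\lambda_k+\gamma_kx}{\mu_k+\gamma_k}\,dx\qquad(0\log0=0);$$ its partial derivatives are computed from this formula viewed as a function of independent variables $(y_n)_{n\in\mathcal{X}}\in(0,\infty)^{\mathcal{X}}$. A saddle point is a critical point which is neither a local minimum nor a local maximum; for $g$ on $\mathcal{P}(\mathcal{X})$, a point $y$ with all $y_n>0$ is critical when $\sum_nh_n\frac{\partial g}{\partial y_n}(y)=0$ for all $h\in\mathbb{R}^{\mathcal{X}}$ with $\sum_nh_n=0$, and local extrema are relative to $\mathcal{P}(\mathcal{X})$. *)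

(* Defs.v *)
From HB Require Import structures.
From mathcomp Require Import all_boot all_order all_algebra.
From mathcomp Require Import all_classical all_reals all_analysis.

Import Order.TTheory GRing.Theory Num.Theory.
Import numFieldNormedType.Exports.

Local Open Scope classical_set_scope.
Local Open Scope ring_scope.

(* The finite set {n in N^K : A_1 n_1 + ... + A_K n_K <= C}.  The bound n_k <= C
   built into the type costs nothing when all A_k >= 1: see [state_of_nat]. *)
Definition state {K : nat} (C : nat) (A : 'I_K -> nat) : finType :=
  {n : {ffun 'I_K -> 'I_C.+1} | (\sum_(k < K) A k * n k <= C)%N}.

Definition occ {K C : nat} {A : 'I_K -> nat} (n : state C A) (k : 'I_K) : nat :=
  val n k.

Lemma state_of_nat (K C : nat) (A : 'I_K -> nat) (m : 'I_K -> nat) :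
  (forall k, (1 <= A k)%N) -> (\sum_(k < K) A k * m k <= C)%N ->
  exists! n : state C A, forall k, occ n k = m k.
Proof.
move=> A1 mC.
have mlt k : (m k < C.+1)%N.
  rewrite ltnS (leq_trans _ mC)// (bigD1 k)//=.
  by rewrite (leq_trans (leq_pmull _ (A1 k)))// leq_addr.
have fC : (\sum_(k < K) A k * [ffun k => Ordinal (mlt k)] k <= C)%N.
  by rewrite (eq_bigr (fun k => A k * m k)%N)// => k _; rewrite ffunE.
exists (exist (fun n : {ffun 'I_K -> 'I_C.+1} => \sum_(k < K) A k * n k <= C)%N
  _ fC); split=> [k|n nm]; first by rewrite /occ /= ffunE.
by apply/val_inj/ffunP => k; apply/val_inj; rewrite /= ffunE /= -nm.
Qed.

Section local_extrema.
Context {R : realType} {V : normedModType R}.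
Implicit Types (D : set V) (f : V -> R) (x : V).

Definition local_min_on D f x :=
  D x /\ \forall z \near within D (nbhs x), f x <= f z.

Definition local_max_on D f x :=
  D x /\ \forall z \near within D (nbhs x), f z <= f x.

Definition saddle_on (crit : set V) D f x :=
  [/\ crit x, ~ local_min_on D f x & ~ local_max_on D f x].

End local_extrema.

Definition partial {R : realType} {N : nat} (i : 'I_N) (f : 'rV[R]_N -> R) :
  'rV[R]_N -> R := 'D_(delta_mx 0 i) f.

Definition gradient {R : realType} {N : nat} (f : 'rV[R]_N -> R)
    (x : 'rV[R]_N) : 'rV[R]_N :=
  \row_i partial i f x.

Definition hessian {R : realType} {N : nat} (f : 'rV[R]_N -> R)
    (x : 'rV[R]_N) : 'M[R]_N :=
  \matrix_(i, j) partial i (partial j f) x.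

Definition orthant {R : realType} {N : nat} : set 'rV[R]_N :=
  [set x | forall i, 0 < x 0 i].

Section model.
Context {R : realType} {K : nat} (C : nat) (A : 'I_K -> nat).
Context (lambda gamma mu : 'I_K -> R).

Local Notation X := (state C A).

(* R^X is represented by row vectors indexed by the enumeration of X. *)
Definition at_state (y : 'rV[R]_#|X|) (n : X) : R := y 0 (enum_rank n).

Definition distributions : set 'rV[R]_#|X| :=
  [set y | (forall n : X, 0 <= at_state y n) /\ \sum_(n : X) at_state y n = 1].

Definition state_fact (n : X) : nat := (\prod_(k < K) (occ n k)`!)%N.

Definition weight (rho : 'rV[R]_K) (n : X) : R :=
  (\prod_(k < K) rho 0 k ^+ occ n k) / (state_fact n)%:R.

Definition Zpart (rho : 'rV[R]_K) : R := \sum_(n : X) weight rho n.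

Definition nu (rho : 'rV[R]_K) : 'rV[R]_#|X| :=
  \row_i ((Zpart rho)^-1 * weight rho (enum_val i)).

Definition alpha (k : 'I_K) : R := lambda k / gamma k.

Definition beta (k : 'I_K) : R := (gamma k + mu k) / gamma k.

Definition phi (rho : 'rV[R]_K) : R :=
  - ln (Zpart rho) + \sum_(k < K) (beta k * rho 0 k - alpha k * ln (rho 0 k)).

Definition mean (k : 'I_K) (y : 'rV[R]_#|X|) : R :=
  \sum_(m : X) (occ m k)%:R * at_state y m.

(* Since 0 * ln 0 = 0, the convention 0 log 0 = 0 holds.  The Lebesgue integral
   over [0, mean k y] is the oriented one as long as 0 <= mean k y, which is so
   at every y with nonnegative coordinates. *)
Definition g (y : 'rV[R]_#|X|) : R :=
  \sum_(n : X) at_state y n * ln ((state_fact n)%:R * at_state y n)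
  - \sum_(k < K) \int[lebesgue_measure]_(x in `[0, mean k y])
      ln ((lambda k + gamma k * x) / (mu k + gamma k)).

Definition phi_critical : set 'rV[R]_K :=
  [set rho | orthant rho /\ gradient phi rho = 0].

Definition g_critical : set 'rV[R]_#|X| :=
  [set y | [/\ distributions y, forall n : X, 0 < at_state y n &
    forall h : 'rV[R]_#|X|, \sum_i h 0 i = 0 ->
      \sum_i h 0 i * partial i g y = 0]].

End model.

Arguments at_state {R K C A} y n.
Arguments state_fact {K C A} n.
Arguments mean {R K C A} k y.
Arguments weight {R K C A} rho n.

(* Main.v *)
Require Import Defs.
From mathcomp Require Import all_boot all_order all_algebra.
From mathcomp Require Import all_classical all_reals all_analysis.
From mathcomp Require Import ring lra.
Import Order.TTheory GRing.Theory Num.Theory.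
Import numFieldNormedType.Exports.
Local Open Scope classical_set_scope.
Local Open Scope ring_scope.
Set Implicit Arguments.
Unset Strict Implicit.
Unset Printing Implicit Defensive.

(** The theorem rests on one identity linking g and phi.  Write
    d(x, y) = x ln (x / y) - x + y for the relative entropy of x >= 0 and y > 0;
    it is nonnegative and vanishes only on the diagonal.  Integrating
    the logarithms in g explicitly and completing the entropies gives, for
    every positive rho and every nonnegative y of total mass S,
      g(y) = phi(rho) + c + (S - 1) (1 - ln Z(rho))
             + sum_n d(y_n, nu_rho(n))
             - sum_k d(alpha_k + <I_k, y>, beta_k rho_k)
    with c independent of y and rho ([g_expansion]).

    Two choices of rho and y make one of the two entropy sums vanish.  Taking
    rho_k = (alpha_k + <I_k, y>) / beta_k, the vector fitted to y, kills the
    second sum, so g(y) >= phi(fitted y) + c ([phi_fitted_le]).  Taking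
    y = nu_rho kills the first, so g(nu_rho) <= phi(rho) + c ([g_nu_le]).  When
    rho is balanced, that is alpha_k + <I_k, nu_rho> = beta_k rho_k for all k,
    both vanish and g(nu_rho) = phi(rho) + c.  Being balanced is the critical
    point equation of phi, and it is also the first order condition for g at
    nu_rho along the transfers of mass from the empty state to a state with
    one customer ([local_min_phi_balanced], [local_min_g_balanced]).  Since
    rho |-> nu_rho and y |-> fitted y are continuous, and exchange rho and
    nu_rho when rho is balanced, local minimality passes from phi to g by the
    first inequality and from g to phi by the second.

    For saddle points, d(., y) has zero derivative at y, so the identity shows
    at once that all partial derivatives of g at nu_rho equal 1 - ln Z(rho)
    when rho is balanced; hence nu_rho is critical.  It is not a local minimum
    by the first part, and it is never a local maximum: moving a small mass s
    from the empty state to a state with a single customer of class k changes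
    one term of the negative sum only, from base point
    alpha_k + <I_k, nu_rho> to that plus s, and this loss is dominated by the
    entropy gained at the target state, whose base mass is smaller
    ([relent_addr], [balanced_not_local_max]). *)

(** * Relative entropy of two numbers *)

Section relative_entropy.
Context {R : realType}.
Implicit Types a b s t u x y : R.

(** The Bregman divergence of x ln x, that is the generalized Kullback-Leibler
    term; the value at x = 0 is y. *)
Definition relent x y := x * ln (x / y) - x + y.

Lemma relentxx y : 0 < y -> relent y y = 0.
Proof. by move=> y0; rewrite /relent divff ?gt_eqF// ln1 mulr0 add0r addNr. Qed.

Lemma relent_gt0 x y : 0 <= x -> 0 < y -> x != y -> 0 < relent x y.
Proof.
rewrite /relent le_eqVlt => /predU1P[<- y0 _|x0 y0 xy].
  by rewrite mul0r subr0 add0r.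
have : ln (y / x) != 0.
  rewrite ln_eq0 ?divr_gt0//; apply: contra xy => /eqP yx1.
  by rewrite -[y](divfK (lt0r_neq0 x0)) yx1 mul1r.
move=> /expR_gt1Dx; rewrite lnK ?posrE ?divr_gt0//.
rewrite ln_div ?posrE// ln_div ?posrE// -(ltr_pM2r x0) divfK ?gt_eqF//.
lra.
Qed.

Lemma relent_ge0 x y : 0 <= x -> 0 < y -> 0 <= relent x y.
Proof.
move=> x0 y0; have [->|xy] := eqVneq x y; first by rewrite relentxx.
exact/ltW/relent_gt0.
Qed.

Lemma relent_scaler x y u : 0 <= x -> 0 < y -> 0 < u ->
  relent x (u * y) = relent x y - x * ln u + (u - 1) * y.
Proof.
rewrite /relent le_eqVlt => /predU1P[<- y0 u0|x0 y0 u0]; first by ring.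
rewrite !ln_div ?posrE ?mulr_gt0// lnM ?posrE//; ring.
Qed.

(** The log-sum inequality: [relent] is jointly convex and homogeneous, hence
    subadditive, and the common part [b] of the second summand contributes
    nothing.  The same increment [s] is thus cheaper over a larger base. *)
Lemma relent_addr a s b : 0 < a -> 0 <= b -> 0 < a + s ->
  relent (a + b + s) (a + b) <= relent (a + s) a.
Proof.
rewrite [0 <= b]le_eqVlt => a0 /predU1P[<- _|b0 as0]; first by rewrite addr0.
set u := (a + b + s) / (a + b).
have ab0 : 0 < a + b by rewrite addr_gt0.
have u0 : 0 < u by rewrite divr_gt0// addrAC addr_gt0.
have uE : u * (a + b) = a + b + s by rewrite divfK// gt_eqF.
(* Comparing both parts with the common ratio u is the dual form of
   subadditivity: the two nonnegative quantities below add up to the claim. *)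
have H1 : 0 <= relent (a + s) (u * a) by apply: relent_ge0; [exact: ltW|exact: mulr_gt0].
have H2 : 0 <= relent b (u * b) by apply: relent_ge0; [exact: ltW|exact: mulr_gt0].
rewrite (relent_scaler (ltW as0))// in H1.
rewrite (relent_scaler (ltW b0))// relentxx// in H2.
rewrite {1}/relent -/u; nra.
Qed.

Lemma is_derive_relent x y : 0 < x -> 0 < y ->
  is_derive x 1 (relent^~ y) (ln (x / y)).
Proof.
move=> x0 y0.
have dln : is_derive x 1 (@ln R \o ( *%R^~ y^-1)) ((x / y)^-1 * y^-1).
  apply: is_derive1_comp; first by apply: is_derive1_ln; rewrite divr_gt0.
  by apply: is_derive_eq; rewrite scaler0 add0r /GRing.scale/= mulr1.
rewrite (_ : relent^~ y = (fun x => x * (@ln R \o ( *%R^~ y^-1)) x - x + y))//.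
apply: is_derive_eq; rewrite /GRing.scale/=.
by field; rewrite !gt_eqF.
Qed.

(** The antiderivative of the logarithm comes out as an entropy, which is what
    lets the integrals of [g] combine with its first sum. *)
Lemma Rintegral_ln_affine a b t : 0 < a -> 0 < b -> 0 <= t ->
  \int[lebesgue_measure]_(x in `[0, t]) ln ((a + x) / b) =
  relent (a + t) b - relent a b.
Proof.
move=> a0 b0; rewrite le_eqVlt => /predU1P[<-|t0].
  by rewrite set_itv1 Rintegral_set1 addr0 subrr.
pose F x := relent (a + x) b.
have dF x : 0 <= x -> is_derive x 1 F (ln ((a + x) / b)).
  move=> x0; rewrite -[ln _]mulr1; apply: (is_derive1_comp (f := relent^~ b)).
    by apply: is_derive_relent => //; rewrite ltr_wpDr.
  by apply: is_derive_eq; rewrite add0r.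
have cF x : 0 <= x -> {for x, continuous F}.
  by move=> /dF dFx; apply/differentiable_continuous/derivable1_diffP.
rewrite /Rintegral (@continuous_FTC2 _ (fun x => ln ((a + x) / b)) F)//.
- by rewrite -EFinB/= /F addr0.
- apply: continuous_in_subspaceT => x; rewrite inE/= in_itv/= => /andP[x0 _].
  apply: continuous_comp; last first.
    by apply: continuous_ln; rewrite divr_gt0// ltr_wpDr.
  apply: cvgMl; apply: cvgD; [exact: cvg_cst|exact: cvg_id].
- split.
  + by move=> x; rewrite in_itv/= => /andP[x0 _]; have [] := dF x (ltW x0).
  + exact/cvg_at_right_filter/cF.
  + by apply/cvg_at_left_filter/cF; exact: ltW.
- move=> x; rewrite in_itv/= => /andP[x0 _]; rewrite derive1E.
  by have [_ ->] := dF x (ltW x0).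
Qed.

End relative_entropy.

(** * Directional derivatives and the first order condition *)

Section directional_derivatives.
Context {R : realType} {V : normedModType R}.
Implicit Types (x v : V) (f : V -> R).

(** Restricting to a line gives access to the one-variable chain rule without
    asking for Frechet differentiability. *)
Lemma is_derive_line f x v df :
  is_derive x v f df <-> is_derive (0 : R) 1 (fun s : R => f (s *: v + x)) df.
Proof.
have E : (fun h : R => h^-1 *: ((f \o shift x) (h *: v) - f x)) =
    (fun h : R => h^-1 *: (((fun s : R => f (s *: v + x)) \o shift 0) (h *: 1)
       - f (0 *: v + x))).
  by apply/funext => h /=; rewrite addr0 scale0r add0r [_%:A]mulr1.
by split=> -[df1 df2]; split; move: df1 df2; rewrite /derivable /derive E.
Qed.

Lemma is_derive_comp (h : R -> R) f x v dh df :
  is_derive (f x) 1 h dh -> is_derive x v f df ->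
  is_derive x v (h \o f) (dh * df).
Proof.
move=> dh1 /is_derive_line df1; apply/is_derive_line.
by apply: (is_derive1_comp (f := h)) => //; rewrite scale0r add0r.
Qed.

Lemma is_derive_big (I : Type) (r : seq I) (F : I -> V -> R) x v
    (dF : I -> R) :
  (forall i, is_derive x v (F i) (dF i)) ->
  is_derive x v (fun z => \sum_(i <- r) F i z) (\sum_(i <- r) dF i).
Proof.
move=> dFi; elim: r => [|i r IH].
  rewrite big_nil (_ : (fun _ => _) = cst 0); first exact: is_derive_cst.
  by apply/funext => z; rewrite big_nil.
rewrite big_cons (_ : (fun _ => _) = F i + (fun z => \sum_(j <- r) F j z)).
  exact: is_deriveD.
by apply/funext => z; rewrite big_cons.
Qed.

Lemma cvg_line x v : (s *: v + x) @[s --> (0 : R)] --> x.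
Proof.
rewrite -[X in _ --> X]add0r -[X in _ --> X + _](scale0r v).
by apply: cvgD; [apply: cvgZr_tmp; exact: cvg_id|exact: cvg_cst].
Qed.

(** The direction only needs to stay in the domain near the point, so the
    condition also applies to the simplex, which has empty interior; and [f]
    only needs a derivative at the point itself, which a slope function
    continuous at 0 expresses. *)
Lemma local_min_derive0 (D : set V) f x v d :
  local_min_on D f x -> (\forall s \near (0 : R), D (s *: v + x)) ->
  is_derive x v f d -> d = 0.
Proof.
move=> [_ fmin] Dline /is_derive_line/is_derive1_caratheodory[k [kE kc k0]].
have {fmin}fmin : \forall s \near (0 : R), 0 <= k s * s.
  have fminl : \forall s \near (0 : R), D (s *: v + x) -> f x <= f (s *: v + x).
    exact: cvg_line fmin.
  apply: filterS2 Dline fminl => s Ds /(_ Ds).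
  by have := kE s; rewrite subr0 scale0r add0r => <-; rewrite subr_ge0.
apply/eqP; apply: contraT => d0.
have kd : \forall s \near (0 : R), 0 < k s * d.
  have : (k s * d) @[s --> (0 : R)] --> k 0 * d.
    by apply: cvgMl; exact: kc.
  rewrite k0 => /cvgr_gt; apply.
  by rewrite -expr2 exprn_even_gt0.
have /nbhs_ballP[e /= e0 He] : \forall s \near (0 : R), 0 <= k s * s /\ 0 < k s * d.
  by near=> s; split; near: s.
(* A step against the sign of d contradicts the minimality. *)
have se : ball (0 : R) e (- (e / 2) * Num.sg d).
  rewrite /ball/= sub0r mulNr opprK normrM normr_sg d0 mulr1 gtr0_norm//; lra.
have [] := He _ se; set z := k _ => kz1 kz2.
have : 0 <= (z * (- (e / 2) * Num.sg d)) * `|d| by rewrite mulr_ge0.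
have -> : (z * (- (e / 2) * Num.sg d)) * `|d| = - (e / 2 * (z * d)).
  by rewrite {3}(numEsg d); ring.
by rewrite oppr_ge0 leNgt mulr_gt0// divr_gt0.
Unshelve. all: by end_near. Qed.

End directional_derivatives.

(** * Convergence and positivity of row vectors *)

Section row_vectors.
Context {R : realType} {N : nat}.
Implicit Types x v : 'rV[R]_N.

Lemma cvg_rV {T : Type} (F : set_system T) {FF : Filter F}
    (f : T -> 'rV[R]_N) x :
  (forall i, (fun t => f t 0 i) @ F --> x 0 i) -> f @ F --> x.
Proof.
move=> fx; apply/cvg_ballP => e e0.
have : \forall t \near F, forall i, ball (x 0 i) e (f t 0 i).
  by apply: filter_forall => i; move: e e0; apply/cvg_ballP; exact: fx.
by apply: filterS => t fxt; split=> // i j; rewrite ord1; exact: fxt.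
Qed.

Lemma is_derive_coord (i : 'I_N) x v :
  is_derive x v (fun z => z 0 i) (v 0 i).
Proof.
apply/is_derive_line.
rewrite (_ : (fun _ => _) = (fun s : R => s * v 0 i + x 0 i)); last first.
  by apply/funext => s; rewrite !mxE.
apply: is_derive_eq.
by rewrite scaler0 add0r addr0 /GRing.scale/= mulr1.
Qed.

Lemma near_orthant x : orthant x -> \forall z \near x, orthant z.
Proof.
move=> x0.
apply: (@filter_forall _ _ (fun i (z : 'rV[R]_N) => 0 < z 0 i) (nbhs x)) => i.
by have /= /(@cvgr_gt R) := @coord_continuous R 1 N 0 i x; apply.
Qed.

End row_vectors.

(** * The entropy identity linking g and phi *)

Section stationary_points.
Context {R : realType} {K : nat} (C : nat) (A : 'I_K -> nat).
Context (lambda gamma mu : 'I_K -> R).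
Context (A_bounds : forall k, (1 <= A k <= C)%N).
Context (lambda_gt0 : forall k, 0 < lambda k).
Context (gamma_gt0 : forall k, 0 < gamma k).
Context (mu_ge0 : forall k, 0 <= mu k).

Local Notation X := (state C A).
Local Notation alpha := (alpha lambda gamma).
Local Notation beta := (beta gamma mu).
Local Notation Z := (Zpart C A).
Local Notation nu := (nu C A).
Local Notation phi := (phi C A lambda gamma mu).
Local Notation g := (g C A lambda gamma mu).
Local Notation simplex := (distributions C A).
Implicit Types (rho v : 'rV[R]_K) (y h : 'rV[R]_#|X|) (k : 'I_K) (n : X).

Lemma alpha_gt0 k : 0 < alpha k.
Proof. by rewrite divr_gt0. Qed.

Lemma beta_gt0 k : 0 < beta k.
Proof. by rewrite divr_gt0// ltr_wpDr. Qed.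

Lemma empty_state : {n : X | forall k, occ n k = 0%N}.
Proof.
apply: cid; have [||n [n0 _]] := @state_of_nat K C A (fun=> 0%N); last by exists n.
- by move=> k; have /andP[] := A_bounds k.
- by rewrite big1// => k _; rewrite muln0.
Qed.

Lemma single_state k : {n : X | forall j, occ n j = (j == k)}.
Proof.
apply: cid; have [||n [n0 _]] := @state_of_nat K C A (fun j => j == k); last by exists n.
- by move=> j; have /andP[] := A_bounds j.
- rewrite (bigD1 k)//= eqxx muln1 big1 ?addn0; first by have /andP[] := A_bounds k.
  by move=> j /negbTE ->; rewrite muln0.
Qed.

Lemma sum_at_state y : \sum_n at_state y n = \sum_i y 0 i.
Proof.
rewrite /at_state [RHS](reindex enum_rank)//=.
by exists enum_val => i _; [exact: enum_rankK|exact: enum_valK].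
Qed.

Lemma at_state_line s h y n :
  at_state (s *: h + y) n = s * at_state h n + at_state y n.
Proof. by rewrite /at_state !mxE. Qed.

Lemma mean_line s h y k : mean k (s *: h + y) = s * mean k h + mean k y.
Proof.
rewrite /mean mulr_sumr -big_split/=; apply: eq_bigr => n _.
by rewrite at_state_line; ring.
Qed.

Lemma mean_ge0 y k : (forall n, 0 <= at_state y n) -> 0 <= mean k y.
Proof. by move=> y0; apply: sumr_ge0 => n _; rewrite mulr_ge0. Qed.

Lemma state_fact_gt0 n : 0 < (state_fact n)%:R :> R.
Proof. by rewrite ltr0n prodn_gt0// => k; exact: fact_gt0. Qed.

Lemma weight_gt0 rho n : orthant rho -> 0 < weight rho n.
Proof.
by move=> rho0; rewrite divr_gt0 ?state_fact_gt0// prodr_gt0// => k _; rewrite exprn_gt0.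
Qed.

Lemma Zpart_gt0 rho : orthant rho -> 0 < Z rho.
Proof.
move=> rho0; have [n0 _] := empty_state.
rewrite /Zpart (bigD1 n0)//= ltr_pwDl ?weight_gt0//.
by apply: sumr_ge0 => n _; exact/ltW/weight_gt0.
Qed.

Lemma at_state_nu rho n : at_state (nu rho) n = (Z rho)^-1 * weight rho n.
Proof. by rewrite /at_state mxE enum_rankK. Qed.

Lemma nu_gt0 rho n : orthant rho -> 0 < at_state (nu rho) n.
Proof.
by move=> rho0; rewrite at_state_nu mulr_gt0 ?invr_gt0 ?Zpart_gt0 ?weight_gt0.
Qed.

Lemma sum_nu rho : orthant rho -> \sum_n at_state (nu rho) n = 1.
Proof.
move=> rho0; under eq_bigr do rewrite at_state_nu.
by rewrite -mulr_sumr mulVf// gt_eqF// Zpart_gt0.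
Qed.

Lemma nu_simplex rho : orthant rho -> simplex (nu rho).
Proof. by move=> rho0; split; [move=> n; exact/ltW/nu_gt0|exact: sum_nu]. Qed.

(** The exponential form is valid on the positive orthant, which is open; it
    is the form convenient for logarithms and derivatives. *)
Lemma weightE rho n : orthant rho ->
  weight rho n = (state_fact n)%:R^-1 * expR (\sum_k (occ n k)%:R * ln (rho 0 k)).
Proof.
move=> rho0; rewrite /weight mulrC expR_sum; congr (_ * _).
by apply: eq_bigr => k _; rewrite mulr_natl -lnXn// lnK// posrE exprn_gt0.
Qed.

Lemma ln_fact_nu rho n : orthant rho ->
  ln ((state_fact n)%:R * at_state (nu rho) n) =
  \sum_k (occ n k)%:R * ln (rho 0 k) - ln (Z rho).
Proof.
move=> rho0; rewrite at_state_nu weightE// mulrCA mulVKf ?gt_eqF ?state_fact_gt0//.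
rewrite lnM ?posrE ?invr_gt0 ?Zpart_gt0 ?expR_gt0//.
by rewrite lnV ?posrE ?Zpart_gt0// expRK addrC.
Qed.

Lemma gE y : (forall n, 0 <= at_state y n) ->
  g y = \sum_n at_state y n * ln ((state_fact n)%:R * at_state y n) -
    \sum_k (relent (alpha k + mean k y) (beta k) - relent (alpha k) (beta k)).
Proof.
move=> y0; rewrite /g; congr (_ - _); apply: eq_bigr => k _.
rewrite -Rintegral_ln_affine ?alpha_gt0 ?beta_gt0 ?mean_ge0//.
congr Rintegral; apply/funext => x; congr ln; rewrite /alpha /beta.
by field; rewrite !gt_eqF// ltr_wpDr.
Qed.

(** The difference between [g] at [nu rho] and [phi] at [rho], common to all
    critical points. *)
Definition offset : R := \sum_k (relent (alpha k) (beta k) - beta k).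

(** The term in the total mass disappears on the simplex; it is kept because
    partial derivatives of [g] leave the simplex.  Both parts of [g] are treated
    by changing the reference point of an entropy: the terms in ln rho_k that
    appear cancel, up to those of [phi]. *)
Lemma g_expansion rho y : orthant rho -> (forall n, 0 <= at_state y n) ->
  g y = phi rho + offset
    + (\sum_n at_state y n - 1) * (1 - ln (Z rho))
    + \sum_n relent (at_state y n) (at_state (nu rho) n)
    - \sum_k relent (alpha k + mean k y) (beta k * rho 0 k).
Proof.
move=> rho0 y0; rewrite gE//.
have entropyE n : at_state y n * ln ((state_fact n)%:R * at_state y n) =
    relent (at_state y n) (at_state (nu rho) n) + at_state y n - at_state (nu rho) n
    + \sum_k (occ n k)%:R * at_state y n * ln (rho 0 k) - at_state y n * ln (Z rho).
  have -> : \sum_k (occ n k)%:R * at_state y n * ln (rho 0 k) =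
      at_state y n * (ln ((state_fact n)%:R * at_state (nu rho) n) + ln (Z rho)).
    rewrite ln_fact_nu// subrK mulr_sumr; apply: eq_bigr => k _; ring.
  rewrite /relent; have := y0 n; rewrite le_eqVlt => /predU1P[<-|yn0]; first by ring.
  rewrite ln_div ?posrE ?nu_gt0// !lnM ?posrE ?nu_gt0 ?state_fact_gt0//; ring.
have relentE k : relent (alpha k + mean k y) (beta k * rho 0 k) =
    relent (alpha k + mean k y) (beta k) - mean k y * ln (rho 0 k)
    + (beta k * rho 0 k - alpha k * ln (rho 0 k)) - beta k.
  rewrite [beta k * _]mulrC relent_scaler ?beta_gt0 ?addr_ge0 ?mean_ge0//; last first.
    exact/ltW/alpha_gt0.
  ring.
rewrite (eq_bigr _ (fun n _ => entropyE n)) (eq_bigr _ (fun k _ => relentE k)).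
rewrite !big_split/= !sumrN -!mulr_suml sum_nu// exchange_big/=.
under [X in _ + X - _ - _]eq_bigr do rewrite -mulr_suml -/(mean _ _).
rewrite /phi /offset !big_split/= !sumrN; ring.
Qed.

(** * Comparison of g and phi *)

(** The zero in rho of the entropies subtracted in [g_expansion]. *)
Definition fitted y : 'rV[R]_K := \row_k ((alpha k + mean k y) / beta k).

(** The critical point equation of [phi] at [rho]; equivalently, [rho] is fitted
    to [nu rho]. *)
Definition balanced rho := forall k, alpha k + mean k (nu rho) = beta k * rho 0 k.

Lemma fitted_orthant y : (forall n, 0 <= at_state y n) -> orthant (fitted y).
Proof.
move=> y0 k; rewrite mxE divr_gt0 ?beta_gt0//.
by rewrite ltr_wpDr ?mean_ge0// alpha_gt0.
Qed.

Lemma fitted_nu rho : balanced rho -> fitted (nu rho) = rho.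
Proof.
move=> rhoB; apply/rowP => k.
by rewrite mxE rhoB mulrC mulKf// gt_eqF// beta_gt0.
Qed.

Lemma phi_fitted_le y : simplex y -> phi (fitted y) + offset <= g y.
Proof.
move=> [y0 y1]; have f0 := fitted_orthant y0.
rewrite (g_expansion f0 y0) y1 subrr mul0r addr0.
rewrite [X in _ - X]big1 ?subr0; last first.
  move=> k _; rewrite mxE mulrC divfK ?gt_eqF ?beta_gt0// relentxx//.
  by rewrite ltr_wpDr ?mean_ge0// alpha_gt0.
by rewrite lerDl sumr_ge0// => n _; rewrite relent_ge0 ?nu_gt0.
Qed.

Lemma g_nu rho : orthant rho ->
  g (nu rho) = phi rho + offset
    - \sum_k relent (alpha k + mean k (nu rho)) (beta k * rho 0 k).
Proof.
move=> rho0; have [nu0 nu1] := nu_simplex rho0.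
rewrite (g_expansion rho0 nu0) nu1 subrr mul0r addr0.
by rewrite [X in _ + X - _]big1 ?addr0// => n _; rewrite relentxx ?nu_gt0.
Qed.

Lemma g_nu_le rho : orthant rho -> g (nu rho) <= phi rho + offset.
Proof.
move=> rho0; rewrite g_nu// gerBl sumr_ge0// => k _.
apply: relent_ge0; last by rewrite mulr_gt0 ?beta_gt0.
apply: addr_ge0; first exact/ltW/alpha_gt0.
by apply: mean_ge0 => n; exact/ltW/nu_gt0.
Qed.

Lemma g_nu_balanced rho : orthant rho -> balanced rho ->
  g (nu rho) = phi rho + offset.
Proof.
move=> rho0 rhoB; rewrite g_nu// big1 ?subr0// => k _.
by rewrite rhoB relentxx// mulr_gt0 ?beta_gt0.
Qed.

Lemma cvg_fitted y0 : fitted y @[y --> y0] --> fitted y0.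
Proof.
apply: (@cvg_rV _ _ _ (nbhs y0)) => k; rewrite mxE.
under eq_cvg do rewrite mxE.
apply: cvgMl; apply: cvgD; first exact: cvg_cst.
apply: cvg_big => [|n _]; first exact: add_continuous.
by apply: cvgMr; exact: coord_continuous.
Qed.

Lemma cvg_nu rho : orthant rho -> nu rho' @[rho' --> rho] --> nu rho.
Proof.
move=> rho0.
have cvg_weight n : weight rho' n @[rho' --> rho] --> weight rho n.
  apply: (@cvgMl _ _ (nbhs rho)); apply: cvg_big => [|k _]; first exact: mul_continuous.
  apply: (@continuous_cvg _ _ _ _ _ (fun z : 'rV[R]_K => z 0 k) (fun x : R => x ^+ _)).
    exact: exprn_continuous.
  exact: coord_continuous.
apply: (@cvg_rV _ _ _ (nbhs rho)) => i; rewrite mxE.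
under eq_cvg do rewrite mxE.
apply: cvgM; last exact: cvg_weight.
apply: cvgV; first by rewrite gt_eqF// Zpart_gt0.
by apply: cvg_big => [|n _]; [exact: add_continuous|exact: cvg_weight].
Qed.

(** * Derivatives of phi and g *)

Lemma is_derive_ln_coord rho v k : orthant rho ->
  is_derive rho v (fun z : 'rV[R]_K => ln (z 0 k)) (v 0 k / rho 0 k).
Proof.
move=> rho0; rewrite mulrC.
apply: (is_derive_comp (h := @ln R) (f := fun z : 'rV[R]_K => z 0 k)).
  exact: is_derive1_ln.
exact: is_derive_coord.
Qed.

Lemma is_derive_weight rho v n : orthant rho ->
  is_derive rho v (fun z => weight z n)
    (weight rho n * \sum_k (occ n k)%:R * (v 0 k / rho 0 k)).
Proof.
move=> rho0.
pose u (z : 'rV[R]_K) := \sum_k (occ n k)%:R * ln (z 0 k) : R.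
apply: (@near_eq_is_derive _ _ _ ((state_fact n)%:R^-1 \*: (@expR R \o u))).
  by apply: filterS (near_orthant rho0) => z z0; rewrite weightE.
have du : is_derive rho v u (\sum_k (occ n k)%:R * (v 0 k / rho 0 k)).
  apply: is_derive_big => k.
  exact: (is_deriveZ _ (is_derive_ln_coord v k rho0)).
rewrite weightE// -mulrA.
exact: (is_deriveZ _ (is_derive_comp (is_derive_expR (u rho)) du)).
Qed.

(** The derivative of ln Z is the mean of [nu rho]: differentiating a weight
    brings down the occupation numbers. *)
Lemma is_derive_phi rho v : orthant rho ->
  is_derive rho v phi
    (\sum_k v 0 k / rho 0 k * (beta k * rho 0 k - (alpha k + mean k (nu rho)))).
Proof.
move=> rho0.
have dlnZ : is_derive rho v (fun z => ln (Z z))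
    (\sum_k v 0 k / rho 0 k * mean k (nu rho)).
  have -> : \sum_k v 0 k / rho 0 k * mean k (nu rho) = (Z rho)^-1 *
      \sum_(n : X) weight rho n * \sum_k (occ n k)%:R * (v 0 k / rho 0 k).
    rewrite mulr_sumr; under [RHS]eq_bigr do rewrite mulrA mulr_sumr.
    rewrite exchange_big/=; apply: eq_bigr => k _; rewrite mulr_sumr.
    by apply: eq_bigr => n _; rewrite at_state_nu; ring.
  apply: (is_derive_comp (h := @ln R)); first exact/is_derive1_ln/Zpart_gt0.
  by apply: is_derive_big => n; exact: is_derive_weight.
have dlin : is_derive rho v
    (fun z : 'rV[R]_K => \sum_k (beta k * z 0 k - alpha k * ln (z 0 k)))
    (\sum_k (beta k * v 0 k - alpha k * (v 0 k / rho 0 k))).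
  apply: is_derive_big => k; apply: is_deriveB.
    exact: (is_deriveZ _ (is_derive_coord k rho v)).
  exact: (is_deriveZ _ (is_derive_ln_coord v k rho0)).
have := is_deriveD (is_deriveN dlnZ) dlin => /is_derive_eq; apply.
rewrite -sumrN -big_split/=; apply: eq_bigr => k _.
by field; rewrite gt_eqF.
Qed.

Lemma is_derive_at_state y h n :
  is_derive y h (fun z => at_state z n) (at_state h n).
Proof. exact: is_derive_coord. Qed.

Lemma is_derive_mean y h k : is_derive y h (mean k) (mean k h).
Proof.
apply: is_derive_big => n.
exact: (is_deriveZ _ (is_derive_at_state y h n)).
Qed.

Lemma near_at_state_gt0 y : (forall n, 0 < at_state y n) ->
  \forall z \near y, forall n, 0 < at_state z n.
Proof.
move=> y0; have /near_orthant : orthant y.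
  by move=> i; have := y0 (enum_val i); rewrite /at_state enum_valK.
by apply: filterS => z z0 n; exact: z0.
Qed.

(** Obtained from [g_expansion] with a free reference [rho]: near a positive
    [y] every term is an entropy, whose derivative is the logarithm of the
    ratio.  With [y = nu rho] the middle sum is zero. *)
Lemma is_derive_g rho y h : orthant rho -> (forall n, 0 < at_state y n) ->
  is_derive y h g
    ((\sum_n at_state h n) * (1 - ln (Z rho))
     + \sum_n ln (at_state y n / at_state (nu rho) n) * at_state h n
     - \sum_k ln ((alpha k + mean k y) / (beta k * rho 0 k)) * mean k h).
Proof.
move=> rho0 y0.
pose f1 (z : 'rV[R]_#|X|) : R := (1 - ln (Z rho)) * \sum_(n : X) at_state z n.
pose f2 (z : 'rV[R]_#|X|) : R := \sum_(n : X) relent (at_state z n) (at_state (nu rho) n).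
pose f3 (z : 'rV[R]_#|X|) : R := \sum_k relent (alpha k + mean k z) (beta k * rho 0 k).
pose c := phi rho + offset - (1 - ln (Z rho)).
apply: (@near_eq_is_derive _ _ _ (cst c + f1 + f2 - f3)).
  apply: filterS (near_at_state_gt0 y0) => z z0.
  rewrite (g_expansion rho0) => [|n]; last exact: ltW.
  by rewrite !fctE /f1 /f2 /f3 /c/=; ring.
have d1 : is_derive y h f1 ((1 - ln (Z rho)) * \sum_n at_state h n).
  apply: (is_deriveZ (1 - ln (Z rho)) (is_derive_big _ _)) => n.
  exact: is_derive_at_state.
have d2 : is_derive y h f2
    (\sum_n ln (at_state y n / at_state (nu rho) n) * at_state h n).
  apply: is_derive_big => n.
  apply: (is_derive_comp (h := relent^~ _)); last exact: is_derive_at_state.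
  by apply: is_derive_relent; rewrite ?nu_gt0.
have d3 : is_derive y h f3
    (\sum_k ln ((alpha k + mean k y) / (beta k * rho 0 k)) * mean k h).
  apply: is_derive_big => k.
  apply: (is_derive_comp (h := relent^~ _) (f := fun z => alpha k + mean k z)).
    apply: is_derive_relent; last by rewrite mulr_gt0 ?beta_gt0.
    by rewrite ltr_wpDr ?alpha_gt0// mean_ge0// => n; exact: ltW.
  by have := is_deriveD (is_derive_cst (alpha k) y h) (is_derive_mean y h k);
    rewrite add0r.
have D := is_deriveB (is_deriveD (is_deriveD (is_derive_cst c y h) d1) d2) d3.
by apply: (is_derive_eq D); ring.
Qed.

(** * Critical points and local minima *)

Lemma phi_critical_balanced rho : orthant rho ->
  (forall k, 'D_(delta_mx 0 k) phi rho = 0) -> balanced rho.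
Proof.
move=> rho0 D0 k; have := D0 k.
have [_ ->] := is_derive_phi (delta_mx 0 k) rho0.
rewrite (bigD1 k)//= big1 ?addr0; last first.
  by move=> j /negbTE jk; rewrite mxE jk andbF mul0r mul0r.
rewrite mxE !eqxx => /eqP; rewrite mulf_eq0 mulf_eq0 oner_eq0/= invr_eq0.
by rewrite gt_eqF//= subr_eq0 => /eqP.
Qed.

Lemma local_min_phi_balanced rho :
  orthant rho -> local_min_on orthant phi rho -> balanced rho.
Proof.
move=> rho0 rho_min; apply: phi_critical_balanced => // k.
have [_ dphi] := is_derive_phi (delta_mx 0 k) rho0; rewrite dphi.
apply: (local_min_derive0 rho_min) (is_derive_phi _ rho0).
by have := @cvg_line _ _ rho (delta_mx 0 k) _ (near_orthant rho0); apply.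
Qed.

Lemma near_simplex_line y h : (forall n, 0 < at_state y n) -> simplex y ->
  \sum_(n : X) at_state h n = 0 -> \forall s \near (0 : R), simplex (s *: h + y).
Proof.
move=> y0 [_ y1] h0.
have line_gt0 : \forall s \near (0 : R), forall n, 0 < at_state (s *: h + y) n.
  by have := @cvg_line _ _ y h _ (near_at_state_gt0 y0); apply.
apply: filterS line_gt0 => s s0.
split=> [n|]; first exact/ltW/s0.
under eq_bigr do rewrite at_state_line.
by rewrite big_split/= -mulr_sumr h0 mulr0 add0r.
Qed.

(** Directions tangent to the simplex, moving mass from [m] to [n]. *)
Definition transfer (m n : X) : 'rV[R]_#|X| :=
  delta_mx 0 (enum_rank n) - delta_mx 0 (enum_rank m).

Lemma at_state_transfer m n i :
  at_state (transfer m n) i = (i == n)%:R - (i == m)%:R.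
Proof. by rewrite /at_state !mxE !(inj_eq enum_rank_inj). Qed.

Lemma mean_transfer m n k :
  mean k (transfer m n) = (occ n k)%:R - (occ m k)%:R.
Proof.
have pick i : \sum_(j : X) (occ j k)%:R * (j == i)%:R = (occ i k)%:R :> R.
  under eq_bigr do rewrite mulr_natr mulrb; rewrite -big_mkcond/=.
  exact: big_pred1_eq.
rewrite /mean; under eq_bigr do rewrite at_state_transfer mulrBr.
by rewrite sumrB !pick.
Qed.

Lemma sum_transfer m n : \sum_i at_state (transfer m n) i = 0.
Proof.
under eq_bigr do rewrite at_state_transfer.
have one j : \sum_(i : X) (i == j)%:R = 1 :> R.
  by under eq_bigr do rewrite mulrb; rewrite -big_mkcond/= big_pred1_eq.
by rewrite sumrB !one subrr.
Qed.

(** Stationarity along the transfer from the empty state to the state with one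
    customer of class [k] isolates the [k]-th logarithm in the derivative of
    [g], which must be zero. *)
Lemma local_min_g_balanced rho :
  orthant rho -> local_min_on simplex g (nu rho) -> balanced rho.
Proof.
move=> rho0 nu_min k.
have nu0 n : 0 < at_state (nu rho) n by exact: nu_gt0.
have [m mE] := empty_state; have [n nE] := single_state k.
have := local_min_derive0 nu_min
  (near_simplex_line nu0 (nu_simplex rho0) (sum_transfer m n))
  (is_derive_g (transfer m n) rho0 nu0).
rewrite sum_transfer mul0r add0r [X in X - _]big1 ?sub0r; last first.
  by move=> i _; rewrite divff ?gt_eqF// ln1 mul0r.
rewrite (bigD1 k)//= [X in _ + X]big1 ?addr0; last first.
  by move=> j /negbTE jk; rewrite mean_transfer nE mE jk subrr mulr0.
rewrite mean_transfer nE mE eqxx subr0 mulr1 => /eqP; rewrite oppr_eq0.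
have br0 : 0 < beta k * rho 0 k by rewrite mulr_gt0 ?beta_gt0.
have am0 : 0 < alpha k + mean k (nu rho).
  by rewrite ltr_wpDr ?alpha_gt0// mean_ge0// => i; exact: ltW.
rewrite ln_eq0 ?divr_gt0// => /eqP ratio1.
by rewrite -[LHS](divfK (lt0r_neq0 br0)) ratio1 mul1r.
Qed.

(** Near [nu rho], g(y) >= phi(fitted y) + c >= phi(rho) + c = g(nu rho). *)
Lemma local_min_g_of_phi rho : orthant rho ->
  local_min_on orthant phi rho -> local_min_on simplex g (nu rho).
Proof.
move=> rho0 rho_min; have rhoB := local_min_phi_balanced rho0 rho_min.
split; first exact: nu_simplex.
have near_fit : \forall y \near nu rho,
    orthant (fitted y) -> phi rho <= phi (fitted y).
  have := cvg_fitted (y0 := nu rho); rewrite fitted_nu// => cvgf.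
  by have [_ phi_le] := rho_min; have near_phi := cvgf _ phi_le; exact: near_phi.
apply: filterS near_fit => y phi_le yD.
rewrite g_nu_balanced// (le_trans _ (phi_fitted_le yD))// lerD2r.
by apply/phi_le/fitted_orthant; case: yD.
Qed.

(** Near [rho], phi(z) + c >= g(nu z) >= g(nu rho) = phi(rho) + c. *)
Lemma local_min_phi_of_g rho : orthant rho ->
  local_min_on simplex g (nu rho) -> local_min_on orthant phi rho.
Proof.
move=> rho0 nu_min; have rhoB := local_min_g_balanced rho0 nu_min.
split=> //.
have near_nu : \forall z \near rho, simplex (nu z) -> g (nu rho) <= g (nu z).
  by have [_ nu_le] := nu_min; have near_g := cvg_nu rho0 nu_le; exact: near_g.
apply: filterS near_nu => z g_le z0.
rewrite -(lerD2r offset) -g_nu_balanced//.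
exact: le_trans (g_le (nu_simplex z0)) (g_nu_le z0).
Qed.

Lemma balanced_g_critical rho : orthant rho -> balanced rho ->
  g_critical C A lambda gamma mu (nu rho).
Proof.
move=> rho0 rhoB; have nu0 n : 0 < at_state (nu rho) n by exact: nu_gt0.
have partialE i : partial i g (nu rho) = 1 - ln (Z rho).
  have [_] := is_derive_g (delta_mx 0 i) rho0 nu0; rewrite /partial => ->.
  rewrite [X in _ - X]big1 ?subr0; last first.
    move=> k _; rewrite rhoB divff ?ln1 ?mul0r//.
    by rewrite gt_eqF// mulr_gt0 ?beta_gt0.
  rewrite [X in _ + X]big1 ?addr0; last first.
    by move=> n _; rewrite divff ?gt_eqF// ln1 mul0r.
  rewrite sum_at_state (bigD1 i)//= mxE !eqxx big1 ?addr0 ?mul1r//.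
  by move=> j /negbTE ji; rewrite mxE ji andbF.
split=> [||h h0]; [exact: nu_simplex|by []|].
by under eq_bigr do rewrite partialE; rewrite -mulr_suml h0 mul0r.
Qed.

(** * Critical points of g are not local maxima *)

(** Along the transfer to a state with one customer of class [k], only two terms
    of the positive entropy sum move, and one of the negative sum.  The mass of
    the target state is part of the mean of class [k], so by [relent_addr] its
    term alone outweighs the negative one; the term of the empty state is a
    strict gain. *)
Lemma balanced_not_local_max rho k : orthant rho -> balanced rho ->
  ~ local_max_on simplex g (nu rho).
Proof.
move=> rho0 rhoB [_ nu_max].
have nu0 n : 0 < at_state (nu rho) n by exact: nu_gt0.
have [m mE] := empty_state; have [n nE] := single_state k.
have mn : m != n.
  by apply/eqP => mn; have := mE k; rewrite mn nE eqxx.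
pose h := transfer m n; pose y (s : R) := s *: h + nu rho.
have near_max : \forall s \near (0 : R), simplex (y s) -> g (y s) <= g (nu rho).
  by have := @cvg_line _ _ (nu rho) h _ nu_max; apply.
have near_D : \forall s \near (0 : R), simplex (y s).
  exact: near_simplex_line nu0 (nu_simplex rho0) (sum_transfer m n).
have /nbhs_ballP[e /= e0 He] :
    \forall s \near (0 : R), simplex (y s) /\ g (y s) <= g (nu rho).
  by apply: filterS2 near_D near_max => s Ds /(_ Ds).
(* Half the radius, so that y s lies in the ball itself. *)
pose s := e / 2; have s0 : 0 < s by rewrite divr_gt0.
have [[y0 y1]] : simplex (y s) /\ g (y s) <= g (nu rho).
  by apply: He; rewrite /ball/= sub0r normrN gtr0_norm// /s; lra.
apply/negP; rewrite -ltNge g_nu_balanced// (g_expansion rho0 y0) y1.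
rewrite subrr mul0r addr0 -[ltRHS]addrA ltrDl subr_gt0.
have atE i : at_state (y s) i = s * ((i == n)%:R - (i == m)%:R) + at_state (nu rho) i.
  by rewrite at_state_line at_state_transfer.
have meanE j : mean j (y s) = s * (j == k)%:R + mean j (nu rho).
  by rewrite mean_line mean_transfer nE mE subr0.
rewrite (bigD1 k)//= [X in _ + X]big1 ?addr0; last first.
  move=> j /negbTE jk; rewrite meanE jk mulr0 add0r rhoB relentxx//.
  by rewrite mulr_gt0 ?beta_gt0.
rewrite (bigD1 n)//= (bigD1 m)//= addrA ltr_wpDr//.
  by apply: sumr_ge0 => i _; apply: relent_ge0.
rewrite !atE meanE !eqxx (negbTE mn) eq_sym (negbTE mn) subr0 sub0r !mulr1.
rewrite -rhoB addrCA [s + at_state _ _]addrC.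
set p := at_state (nu rho) n; set a := alpha k + mean k (nu rho).
have pa : p <= a.
  rewrite /a /mean (bigD1 n)//= nE eqxx mul1r addrCA lerDl.
  apply: addr_ge0; first exact/ltW/alpha_gt0.
  by apply: sumr_ge0 => i _; rewrite mulr_ge0// ltW.
have le_a : relent (a + s) a <= relent (p + s) p.
  have := @relent_addr _ p s (a - p) (nu0 n); rewrite subr_ge0 pa.
  rewrite [p + (a - p)]addrC subrK; apply=> //.
  by rewrite addr_gt0 ?nu0.
rewrite [s + a]addrC; apply: (le_lt_trans le_a); rewrite ltrDl.
apply: relent_gt0 => //.
- by have := y0 m; rewrite atE eqxx (negbTE mn) sub0r.
- by rewrite -subr_eq0 addrK mulrN1 oppr_eq0 gt_eqF.
Qed.

End stationary_points.

(** * The correspondence between extrema of phi and g *)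

Theorem theorem3 (R : realType) (K C : nat) (A : 'I_K -> nat)
    (lambda gamma mu : 'I_K -> R)
    (K_ge1 : (1 <= K)%N) (C_ge1 : (1 <= C)%N)
    (A_bounds : forall k, (1 <= A k <= C)%N)
    (lambda_gt0 : forall k, 0 < lambda k)
    (gamma_gt0 : forall k, 0 < gamma k)
    (mu_ge0 : forall k, 0 <= mu k)
    (nondegenerate : forall rho : 'rV[R]_K, orthant rho ->
       gradient (phi C A lambda gamma mu) rho = 0 ->
       forall a : R,
         eigenvalue (hessian (g C A lambda gamma mu) (nu C A rho)) a ->
         a != 0) :
  (forall rho : 'rV[R]_K, orthant rho ->
     (local_min_on orthant (phi C A lambda gamma mu) rho <->
      local_min_on (distributions C A)
        (g C A lambda gamma mu) (nu C A rho))) /\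
  (forall rho : 'rV[R]_K, orthant rho ->
     saddle_on (phi_critical C A lambda gamma mu) orthant
       (phi C A lambda gamma mu) rho ->
     saddle_on (g_critical C A lambda gamma mu)
       (distributions C A)
       (g C A lambda gamma mu) (nu C A rho)).
Proof.
split=> rho rho0.
  by split; [exact: local_min_g_of_phi|exact: local_min_phi_of_g].
move=> [[_ grad0] not_min _].
have rhoB : balanced C A lambda gamma mu rho.
  apply: phi_critical_balanced => // k.
  by have /rowP/(_ k) := grad0; rewrite !mxE.
split; first exact: balanced_g_critical.
- by move=> nu_min; apply/not_min/local_min_phi_of_g.
- exact: (balanced_not_local_max A_bounds _ _ _ (Ordinal K_ge1)).
Qed.
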